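(* Let $s$ be an integer-valued statistic on a class of combinatorial objects, let $S(m,n)$ be the number of objects of weight $n$ with statistic $m$, and assume the symmetry $S(m,n)=S(-m,n)$ for all $m\in\mathbb{Z}$, $n\ge 0$. Let $G_S(\zeta;q)=\sum_{n\ge 0,\,m\in\mathbb{Z}}S(m,n)\zeta^m q^n$, with $\zeta=e^{2\pi i z}$ and $q=e^{2\pi i\tau}$, and assume that $$G_S(\zeta;q)=\frac{\sin(\pi z)}{\pi z}\,G_S(1;q)\exp\left(2\sum_{n\ge 2}H_n(\tau)\frac{(2\pi i z)^n}{n!}\right).$$ Let $\mathcal{M}_r(q)=\frac{1}{G_S(1;q)}\sum_{n\ge 0}\left(\sum_{m\in\mathbb{Z}}m^rS(m,n)\right)q^n$ be the normalized $r$-th moment generating function. Then for every positive integer $k$, $$\mathcal{M}_{2k}(q)=\mathrm{Tr}_k\left(\phi_M;\,H_2+\frac{B_2}{4},\,H_4+\frac{B_4}{8},\,\ldots,\,H_{2k}+\frac{B_{2k}}{4k}\right),$$ $$H_{2k}=-\frac{B_{2k}}{4k}+\mathrm{Tr}_k\left(\phi_S;\,\mathcal{M}_2(q),\mathcal{M}_4(q),\ldots,\mathcal{M}_{2k}(q)\right),$$ where, for $\lambda=(1^{m_1},2^{m_2},\ldots,k^{m_k})\vdash k$, $$\phi_M(\lambda)=(2k)!\prod_{j=1}^k\frac{2^{m_j}}{m_j!\,((2j)!)^{m_j}},\qquad \phi_S(\lambda)=\frac{(2k)!}{2}(-1)^{\ell(\lambda)-1}(\ell(\lambda)-1)!\p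rod_{j=1}^k\frac{1}{m_j!\,((2j)!)^{m_j}}.$$
   Context: The number of objects of each weight $n\ge 0$ is finite, so for each $n$ only finitely many $S(m,n)$ are nonzero, and $G_S(1;q)=\sum_{n\ge0}S(n)q^n$, where $S(n)$ is the number of objects of weight $n$; $G_S(1;q)$ is not zero, so one may divide by it. The exponential expansion is read as an identity of power series in $z$ whose coefficients are functions of $\tau$ ($q$-series), where $\zeta^m=e^{2\pi i m z}$ is expanded in powers of $z$. $B_n$ denotes the $n$-th Bernoulli number. A partition $\lambda\vdash k$ in frequency notation is $\lambda=(1^{m_1},2^{m_2},\ldots,k^{m_k})$, where $m_j\ge0$ is the multiplicity of the part $j$ and $\sum_j j m_j=k$; its length is $\ell(\lambda)=m_1+\cdots+m_k$. For a function $\phi$ on partitions, the partition trace is $$\mathrm{Tr}_k(\phi;X_1,\ldots,X_k)=\sum_{\lambda\vdash k}\phi(\lambda)\prod_{j=1}^kX_j^{m_j}.$$ *)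

(* Defs.v *)
From HB Require Import structures.
From mathcomp Require Import all_boot all_order all_algebra.
From mathcomp Require Import finmap complex.
From mathcomp Require Import all_classical all_reals all_analysis.

Set Implicit Arguments.
Unset Strict Implicit.
Unset Printing Implicit Defensive.

Import Order.TTheory GRing.Theory Num.Theory.

Local Open Scope classical_set_scope.
Local Open Scope ring_scope.

(* A record rather than [nat -> R], which already carries the pointwise
   product. *)
Record fps (R : Type) := Fps { coefs :> nat -> R }.

Notation "{ 'fps' R }" := (fps R) (format "{ 'fps'  R }") : type_scope.

Lemma fpsP (R : Type) (f g : {fps R}) : (forall n, f n = g n) <-> f = g.
Proof.
split=> [|-> //]; case: f => f; case: g => g /= fg.
by congr Fps; apply/funext.
Qed.

HB.instance Definition _ (R : Type) := gen_eqMixin {fps R}.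
HB.instance Definition _ (R : Type) := gen_choiceMixin {fps R}.

Section Zmodule.
Variable R : zmodType.
Implicit Types f g : {fps R}.

Definition fps_zero : {fps R} := Fps (fun=> 0).
Definition fps_opp f : {fps R} := Fps (fun n => - f n).
Definition fps_add f g : {fps R} := Fps (fun n => f n + g n).

Fact fps_addA : associative fps_add.
Proof. by move=> f g h; apply/fpsP => n; exact: addrA. Qed.
Fact fps_addC : commutative fps_add.
Proof. by move=> f g; apply/fpsP => n; exact: addrC. Qed.
Fact fps_add0 : left_id fps_zero fps_add.
Proof. by move=> f; apply/fpsP => n; exact: add0r. Qed.
Fact fps_addN : left_inverse fps_zero fps_opp fps_add.
Proof. by move=> f; apply/fpsP => n; exact: addNr. Qed.

HB.instance Definition _ :=
  GRing.isZmodule.Build {fps R} fps_addA fps_addC fps_add0 fps_addN.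

Lemma coefs0 n : (0 : {fps R}) n = 0. Proof. by []. Qed.
Lemma coefsD f g n : (f + g) n = f n + g n. Proof. by []. Qed.
Lemma coefsN f n : (- f) n = - f n. Proof. by []. Qed.
End Zmodule.

Section Ring.
Variable R : comNzRingType.
Implicit Types f g : {fps R}.

Definition fpsC (c : R) : {fps R} := Fps (fun n => if n == 0%N then c else 0).
Definition fps_mul f g : {fps R} :=
  Fps (fun n => \sum_(i < n.+1) f i * g (n - i)%N).

Let trunc N f : {poly R} := \poly_(i < N) f i.

Let fps_mulE N f g n : (n < N)%N -> fps_mul f g n = (trunc N f * trunc N g)`_n.
Proof.
move=> nN; rewrite coefM /=; apply: eq_bigr => i _.
rewrite !coef_poly (leq_ltn_trans (leq_subr _ _) nN).
by rewrite (leq_ltn_trans _ nN) // -ltnS.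
Qed.

Let fps_mulAE f g h n :
  fps_mul f (fps_mul g h) n = (trunc n.+1 f * (trunc n.+1 g * trunc n.+1 h))`_n.
Proof.
rewrite coefM; apply: eq_bigr => i _.
by rewrite coef_poly ltn_ord (@fps_mulE n.+1) // ltnS leq_subr.
Qed.

Fact fps_mulC : commutative fps_mul.
Proof.
by move=> f g; apply/fpsP => n; rewrite !(@fps_mulE n.+1) // mulrC.
Qed.
Fact fps_mulA : associative fps_mul.
Proof.
move=> f g h; apply/fpsP => n.
by rewrite [fps_mul (fps_mul f g) h]fps_mulC !fps_mulAE mulrA mulrC.
Qed.
Fact fps_mul1 : left_id (fpsC 1) fps_mul.
Proof.
move=> f; apply/fpsP => n; rewrite /= big_ord_recl /= mul1r subn0.
by rewrite big1 ?addr0 // => i _; rewrite mul0r.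
Qed.
Fact fps_mulD : left_distributive fps_mul +%R.
Proof.
move=> f g h; apply/fpsP => n; rewrite coefsD -big_split.
by apply: eq_bigr => i _; rewrite /= mulrDl.
Qed.
Fact fps_one_neq0 : fpsC 1 != 0.
Proof. by apply/eqP => /fpsP/(_ 0%N)/eqP; apply/negP; exact: oner_neq0. Qed.

HB.instance Definition _ := GRing.Zmodule_isComNzRing.Build {fps R}
  fps_mulA fps_mulC fps_mul1 fps_mulD fps_one_neq0.

Lemma coefsM f g n : (f * g) n = \sum_(i < n.+1) f i * g (n - i)%N.
Proof. by []. Qed.

Definition fps_unit : {pred {fps R}} := fun f => `[< exists g, g * f = 1 >].
Definition fps_inv f : {fps R} :=
  if pselect (exists g, g * f = 1) is left fU then projT1 (cid fU) else f.

Fact fps_mulV : {in fps_unit, left_inverse 1 fps_inv *%R}.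
Proof.
move=> f; rewrite unfold_in => /asboolP fU; rewrite /fps_inv.
by case: pselect => // fU'; case: (cid fU').
Qed.
Fact fps_unitP f g : g * f = 1 -> fps_unit f.
Proof. by move=> gf1; apply/asboolP; exists g. Qed.
Fact fps_inv_out : {in [predC fps_unit], fps_inv =1 id}.
Proof.
move=> f; rewrite inE unfold_in => /asboolP fNU; rewrite /fps_inv.
by case: pselect.
Qed.

HB.instance Definition _ := GRing.ComNzRing_hasMulInverse.Build {fps R}
  fps_mulV fps_unitP fps_inv_out.
End Ring.

Section IntegralDomain.
Variable R : idomainType.
Implicit Types f g : {fps R}.

Let fps_order f : f != 0 ->
  exists2 i, f i != 0 & forall j, (j < i)%N -> f j = 0.
Proof.
move=> f0; have exf : exists n, f n != 0.
  apply: contrapT => /forallNP fN; move/eqP: f0; apply; apply/fpsP => n.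
  by apply/eqP; apply: contrapT => /negP; exact: fN.
exists (ex_minn exf); first by case: ex_minnP.
case: ex_minnP => i _ imin j ji; apply/eqP; apply: contraTT ji => fj.
by rewrite -leqNgt imin.
Qed.

Fact fps_mulf_eq0 : GRing.integral_domain_axiom {fps R}.
Proof.
move=> f g fg0; apply: contra_eqT fg0; rewrite negb_or => /andP[].
move=> /fps_order[i fi fmin] /fps_order[j gj gmin].
apply/eqP => /fpsP/(_ (i + j)%N)/eqP; apply/negP; rewrite coefsM coefs0.
have iP : (i < (i + j).+1)%N by rewrite ltnS leq_addr.
rewrite (bigD1 (Ordinal iP)) //= addKn big1 ?addr0 ?mulf_neq0 // => l.
rewrite -val_eqE /= neq_ltn => /orP[/fmin ->|il]; first by rewrite mul0r.
by rewrite (gmin (_ - _)%N) ?mulr0 // ltn_subLR ?ltn_add2r // -ltnS ltn_ord.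
Qed.

HB.instance Definition _ :=
  GRing.ComUnitRing_isIntegral.Build {fps R} fps_mulf_eq0.
End IntegralDomain.

(* [exp f], for [f] without constant term: [f ^+ k] then has no coefficient
   below degree [k], which is why the sum stops at [n]. *)
Definition fps_exp (F : fieldType) (f : {fps F}) : {fps F} :=
  Fps (fun n => \sum_(k < n.+1) (f ^+ k) n / k`!%:R).

(* Normalization [B_1 = - 1 / 2]; see [bernoulli_rec]. *)
Fixpoint bernoulli_seq (n : nat) : seq rat :=
  if n is n'.+1 then
    let s := bernoulli_seq n' in
    rcons s (((n' == 0)%N%:R - \sum_(k < n') 'C(n'.+1, k)%:R * s`_k)
             / n'.+1%:R)
  else [::].
Definition bernoulli (n : nat) : rat := (bernoulli_seq n.+1)`_n.

Lemma size_bernoulli_seq n : size (bernoulli_seq n) = n.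
Proof. by elim: n => //= n IHn; rewrite size_rcons IHn. Qed.

Lemma nth_bernoulli_seq n k :
  (k < n)%N -> (bernoulli_seq n)`_k = bernoulli k.
Proof.
elim: n => // n IHn; rewrite ltnS leq_eqVlt => /orP[/eqP -> //|kn].
by rewrite /= nth_rcons size_bernoulli_seq kn IHn.
Qed.

Lemma bernoulli_rec n :
  \sum_(k < n.+1) 'C(n.+1, k)%:R * bernoulli k = (n == 0)%N%:R.
Proof.
rewrite big_ord_recr /= binSn {2}/bernoulli /= nth_rcons size_bernoulli_seq.
rewrite ltnn eqxx [_%:R * (_ / _)]mulrC divfK ?pnatr_eq0 //.
under [in X in _ + (_ - X)]eq_bigr do rewrite nth_bernoulli_seq //.
by rewrite addrC subrK.
Qed.

(* [l] encodes (1^{l 0}, 2^{l 1}, ..., k^{l (k-1)}): the multiplicity of the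
   part [j.+1] is [l j].  In a partition of [k] multiplicities are at most [k],
   so the codomain loses nothing. *)
Definition freq (k : nat) := {ffun 'I_k -> 'I_k.+1}.
Definition is_partn (k : nat) (l : freq k) : bool :=
  (\sum_(j < k) j.+1 * l j == k)%N.
Definition plength (k : nat) (l : freq k) : nat := (\sum_(j < k) l j)%N.

(* [X] is indexed from 1, so [X 0] is never used. *)
Definition ptrace (F : fieldType) (k : nat) (phi : freq k -> rat)
    (X : nat -> F) : F :=
  \sum_(l | is_partn l) ratr (phi l) * \prod_(j < k) X j.+1 ^+ l j.

Definition phi_M (k : nat) (l : freq k) : rat :=
  (2 * k)`!%:R *
  \prod_(j < k) (2 ^+ l j / ((l j)`!%:R * (2 * j.+1)`!%:R ^+ l j)).

Definition phi_S (k : nat) (l : freq k) : rat :=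
  (2 * k)`!%:R / 2 * (-1) ^+ (plength l).-1 * ((plength l).-1)`!%:R *
  \prod_(j < k) ((l j)`!%:R * (2 * j.+1)`!%:R ^+ l j)^-1.

(* q-series are taken in the fraction field of C[[q]], i.e. the field C((q)) of
   formal Laurent series: G_S(1;q) need not be invertible in C[[q]]. *)
Definition qser (R : realType) := {fraction {fps R[i]}}.

Definition qconst (R : realType) (c : R[i]) : qser R := tofrac (fpsC c).

Definition twopii (R : realType) : R[i] := Complex 0 (2 * pi).

(* e^{az} as a power series in z. *)
Definition expz (R : realType) (a : R[i]) : {fps R[i]} :=
  Fps (fun r => a ^+ r / r`!%:R).

(* sin(pi z)/(pi z): [sin_coeff pi n] is the coefficient of z^n in sin(pi z),
   so dividing by pi z shifts the index by one. *)
Definition sincz (R : realType) : {fps qser R} :=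
  Fps (fun n => qconst (real_complex R (sin_coeff pi n.+1 / pi))).

(* 2 \sum_(n >= 2) H_n (2 pi i z)^n / n! *)
Definition Hexponent (R : realType) (H : nat -> qser R) : {fps qser R} :=
  Fps (fun n => if (2 <= n)%N then
                  2 * H n * qconst (twopii R ^+ n / n`!%:R) else 0).

Section Statistic.
Variables (R : realType) (T : choiceType) (wt : T -> nat) (s : T -> int).

Definition nobj (m : int) (n : nat) : nat :=
  #|` fset_set [set x | wt x = n /\ s x = m] |.

(* \sum_n (\sum_m w m * S(m,n)) q^n; the inner sum is the finite-support sum
   over all of Z. *)
Definition wgf (w : int -> R[i]) : {fps R[i]} :=
  Fps (fun n => \sum_(m \in [set: int]) w m * (nobj m n)%:R).

(* G_S(1;q) *)
Definition G1 : qser R := tofrac (wgf (fun=> 1)).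

(* G_S(e^{2 pi i z};q) as a power series in z. *)
Definition Gz : {fps qser R} :=
  Fps (fun r => tofrac (wgf (fun m => expz (twopii R * m%:~R) r))).

Definition moment (r : nat) : qser R :=
  tofrac (wgf (fun m => m%:~R ^+ r)) / G1.
End Statistic.

Arguments G1 R {T} wt s.
Arguments Gz R {T} wt s.
Arguments moment R {T} wt s r.

(* Main.v *)
(** Put [x = 2 pi i z] and [M = G_S(zeta;q) / G_S(1;q) = \sum_r M_r x^r / r!].
    Since [sin(pi z)/(pi z) = sinh(x/2)/(x/2)
    = exp(\sum_(n >= 2) (B_n / n) x^n / n!)], the hypothesis reads [M = exp f]
    with [f = \sum_(n >= 2) 2 (H_n + B_n / (2n)) x^n / n!].  The symmetry of
    [S] makes [M], hence [f], even, and both formulas come from the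
    multinomial theorem applied to [M = exp f] and [f = log M].  Exponentials
    and logarithms are handled through the equation [x M' = (x f') M]. *)

From HB Require Import structures.
Require Import Defs.
From mathcomp Require Import all_boot all_order all_algebra.
From mathcomp Require Import complex ring zify.
From mathcomp Require Import all_classical all_reals all_analysis.

Set Implicit Arguments.
Unset Strict Implicit.
Unset Printing Implicit Defensive.

Import Order.TTheory GRing.Theory Num.Theory.
Local Open Scope classical_set_scope.
Local Open Scope ring_scope.

(** * Multinomial theorem *)

(** Only factorials are required to be invertible because the ring will be [{fps F}]. The bound [K]
    gives the exponents a type independent of [r], the one used by [freq]. *)
Lemma exprn_sum (A : comUnitRingType)
    (fact_unit : forall n, n`!%:R \is a @GRing.unit A)
    (I : finType) (a : I -> A) (K r : nat) : (r <= K)%N ->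
  (\sum_i a i) ^+ r =
  \sum_(l : {ffun I -> 'I_K.+1} | (\sum_i l i == r)%N)
     r`!%:R * \prod_i (a i ^+ l i / (l i)`!%:R).
Proof.
move=> rK.
(* [e i] truncates [exp(a_i X)]: exponentials turn the sum into a product. *)
pose e i : {poly A} := \poly_(m < K.+1) (a i ^+ m / m`!%:R).
have prod_e : forall n, (n <= K)%N ->
    n`!%:R * (\prod_i e i)`_n = (\sum_i a i) ^+ n.
  (* The relation says that [p] agrees with exp(sX) up to degree [K]; by the binomial theorem it is
     compatible with products of [p] and sums of [s]. *)
  apply: (big_ind2 (fun (p : {poly A}) s => forall n, (n <= K)%N ->
    n`!%:R * p`_n = s ^+ n)) => [n _|p x q y px qy n nK|i _ n nK].
  - by rewrite coef1 expr0n; case: n => [|n]; rewrite ?mulr1 ?mulr0.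
  - rewrite addrC exprDn coefM mulr_sumr; apply: eq_bigr => i _.
    have iN : (i <= n)%N by rewrite -ltnS.
    rewrite -(px i) ?(leq_trans iN) // -qy ?(leq_trans (leq_subr _ _)) //.
    rewrite -(bin_fact iN) !natrM -mulr_natl; ring.
  - by rewrite coef_poly ltnS nK mulrC divrK.
rewrite -prod_e // -mulr_sumr; congr (_ * _).
under eq_bigr do rewrite /e poly_def.
rewrite bigA_distr_bigA coef_sum [RHS]big_mkcond /=; apply: eq_bigr => l _.
rewrite scaler_prod -expr_sum coefZ coefXn eq_sym.
by case: eqP => _; rewrite ?mulr1 ?mulr0.
Qed.

(** * Formal power series and the operator X d/dX *)

Section FormalSeries.
Variable F : fieldType.
Implicit Types (f g : {fps F}) (c : nat -> F).

Lemma coefs_sum (I : Type) (r : seq I) (P : pred I) (f : I -> {fps F}) n :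
  (\sum_(i <- r | P i) f i) n = \sum_(i <- r | P i) f i n.
Proof. exact: (big_morph (fun f : {fps F} => f n)). Qed.

Lemma coefsCM (a : F) f n : (fpsC a * f) n = a * f n.
Proof.
rewrite coefsM big_ord_recl /= subn0 big1 ?addr0 // => i _.
by rewrite mul0r.
Qed.

Lemma coefsMn f m n : (f *+ m) n = f n *+ m.
Proof. by elim: m => // m IHm; rewrite !mulrS coefsD IHm. Qed.

Lemma coefs1 n : (1 : {fps F}) n = (n == 0%N)%:R.
Proof. by rewrite /= /GRing.one /=; case: n. Qed.

Fact fpsC_is_zmod_morphism : zmod_morphism (@fpsC F).
Proof.
move=> a b; apply/fpsP => n; rewrite coefsD coefsN.
by case: n => //= n; rewrite subr0.
Qed.
Fact fpsC_is_monoid_morphism : monoid_morphism (@fpsC F).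
Proof.
split=> // a b; apply/fpsP => n; rewrite coefsCM /=.
by case: n => [|n] //=; rewrite mulr0.
Qed.
HB.instance Definition _ :=
  GRing.isZmodMorphism.Build F {fps F} (@fpsC F) fpsC_is_zmod_morphism.
HB.instance Definition _ :=
  GRing.isMonoidMorphism.Build F {fps F} (@fpsC F) fpsC_is_monoid_morphism.

Definition fpsXn d : {fps F} := Fps (fun n => (n == d)%:R).

Lemma coefsMXn f d n : (f * fpsXn d) n = if (n < d)%N then 0 else f (n - d)%N.
Proof.
rewrite coefsM; case: ltnP => nd.
  rewrite big1 // => i _; rewrite /= (_ : ((n - i)%N == d) = false) ?mulr0 //.
  by apply/negbTE; rewrite neq_ltn (leq_ltn_trans (leq_subr _ _) nd).
have iP : (n - d < n.+1)%N by rewrite ltnS leq_subr.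
rewrite (bigD1 (Ordinal iP)) //= subKn // eqxx mulr1 big1 ?addr0 // => i.
rewrite -val_eqE /= => iN; rewrite (_ : ((n - i)%N == d) = false) ?mulr0 //.
by apply/negbTE; apply: contra iN => /eqP <-; rewrite subKn // -ltnS.
Qed.

Lemma fpsXnD d e : fpsXn (d + e)%N = fpsXn d * fpsXn e.
Proof.
apply/fpsP => n; rewrite coefsMXn /=; case: ltnP => ne.
  by rewrite (_ : (n == _) = false) //; lia.
by rewrite (_ : (n == _) = (n - e == d)%N) //; lia.
Qed.

Lemma fpsXn0 : fpsXn 0 = 1.
Proof. by apply/fpsP => n; rewrite coefs1. Qed.

Lemma fpsXnM d e : fpsXn (d * e)%N = fpsXn d ^+ e.
Proof.
elim: e => [|e IHe]; first by rewrite muln0 fpsXn0.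
by rewrite mulnS fpsXnD IHe exprS.
Qed.

Lemma fpsXn_neq0 d : fpsXn d != 0.
Proof.
by apply/eqP => /fpsP/(_ d)/eqP; rewrite coefs0 /= eqxx oner_eq0.
Qed.

(* [X d/dX]; unlike [d/dX] it does not shift the coefficients. *)
Definition euler f : {fps F} := Fps (fun n => f n *+ n).

Lemma coefs_euler f n : euler f n = f n *+ n.
Proof. by []. Qed.

Fact euler_is_zmod_morphism : zmod_morphism euler.
Proof. by move=> f g; apply/fpsP => n; rewrite coefsD coefsN /= mulrnBl. Qed.
HB.instance Definition _ :=
  GRing.isZmodMorphism.Build {fps F} {fps F} euler euler_is_zmod_morphism.

Lemma euler_sum (I : Type) (r : seq I) (P : pred I) (f : I -> {fps F}) :
  euler (\sum_(i <- r | P i) f i) = \sum_(i <- r | P i) euler (f i).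
Proof. exact: raddf_sum. Qed.

Lemma eulerM f g : euler (f * g) = euler f * g + f * euler g.
Proof.
apply/fpsP => n; rewrite coefsD coefs_euler !coefsM -sumrMnl -big_split /=.
apply: eq_bigr => i _; have iN : (i <= n)%N by rewrite -ltnS.
by rewrite mulrnAl mulrnAr -mulrnDr subnKC.
Qed.

Lemma eulerXn f n : euler (f ^+ n.+1) = (f ^+ n * euler f) *+ n.+1.
Proof.
elim: n => [|n IHn]; first by rewrite expr1 mul1r.
rewrite exprS eulerM IHn [RHS]mulrS exprS; congr (_ + _); first exact: mulrC.
by rewrite mulrnAr mulrA.
Qed.

Lemma eulerC (a : F) : euler (fpsC a) = 0.
Proof. by apply/fpsP => -[|n] /=; rewrite ?mul0rn ?mulr0n. Qed.

Lemma euler_fpsXn d : euler (fpsXn d) = fpsXn d *+ d.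
Proof.
apply/fpsP => n; rewrite coefsMn coefs_euler /=.
by case: eqP => [->|]; rewrite ?mul0rn.
Qed.

(** * Truncation, composition, exponential and logarithm *)

Lemma coefsM_agree N f f' g g' :
    (forall n, (n <= N)%N -> f n = f' n) ->
    (forall n, (n <= N)%N -> g n = g' n) ->
  forall n, (n <= N)%N -> (f * g) n = (f' * g') n.
Proof.
move=> ff' gg' n nN; rewrite !coefsM; apply: eq_bigr => i _.
by rewrite ff' ?gg' ?(leq_trans (leq_subr _ _)) // (leq_trans _ nN) // -ltnS.
Qed.

Lemma coefsX_agree N f f' r : (forall n, (n <= N)%N -> f n = f' n) ->
  forall n, (n <= N)%N -> (f ^+ r) n = (f' ^+ r) n.
Proof.
move=> ff'; elim: r => [//|r IHr] n nN.
by rewrite !exprS (coefsM_agree ff' IHr).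
Qed.

(** Used with d = 1 to truncate compositions, and with d = 2 to bound the powers of an even series
    that reach a given degree. *)
Lemma coefsX_eq0 d f r n : (forall m, (m < d)%N -> f m = 0) ->
  (n < d * r)%N -> (f ^+ r) n = 0.
Proof.
move=> fd; elim: r n => [|r IHr] n; rewrite ?muln0 // mulnS => nr.
rewrite exprS coefsM big1 // => i _.
have [id|di] := ltnP i d; first by rewrite fd ?mul0r.
by rewrite IHr ?mulr0 //; have := ltn_ord i; lia.
Qed.

(* [\sum_k c_k f^k], for [f] without constant term. *)
Definition fps_comp c f : {fps F} :=
  Fps (fun n => \sum_(k < n.+1) (f ^+ k) n * c k).

Lemma fps_expE f : fps_exp f = fps_comp (fun k => (k`!%:R)^-1) f.
Proof. by []. Qed.

(** Powers beyond [N] vanish up to degree [N], so a single finite sum serves all these degrees and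
    the rules for finite sums apply. *)
Lemma fps_compE N c f n : f 0%N = 0 -> (n <= N)%N ->
  fps_comp c f n = (\sum_(k < N.+1) f ^+ k * fpsC (c k)) n.
Proof.
move=> f0 nN; rewrite coefs_sum [LHS]/=.
rewrite (big_ord_widen N.+1 (fun k => (f ^+ k) n * c k)) // big_mkcond.
apply: eq_bigr => i _.
rewrite [f ^+ i * _]mulrC coefsCM mulrC ltnS; case: leqP => // ni.
rewrite (@coefsX_eq0 1) ?mulr0 ?mul1n //.
by case.
Qed.

Lemma euler_comp c f : f 0%N = 0 ->
  euler (fps_comp c f) = euler f * fps_comp (fun k => c k.+1 *+ k.+1) f.
Proof.
move=> f0; apply/fpsP => n.
(* One term more than degree n needs: once the constant term is differentiated away, n + 1 terms
   remain, as in the truncation on the right. *)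
have -> : euler (fps_comp c f) n
    = euler (\sum_(k < n.+2) f ^+ k * fpsC (c k)) n.
  by rewrite !coefs_euler (@fps_compE n.+1).
rewrite (@coefsM_agree n _ (euler f) _ _ _ (fun m mn => fps_compE _ f0 mn)) //.
rewrite euler_sum mulr_sumr !coefs_sum big_ord_recl eulerM eulerC mulr0 addr0.
have -> : euler (f ^+ 0) = 0 by rewrite expr0 -[1]/(fpsC 1) eulerC.
rewrite mul0r coefs0 add0r; apply: eq_bigr => i _; rewrite lift0.
rewrite eulerM eulerC mulr0 addr0 eulerXn rmorphMn; congr (coefs _ n).
by rewrite mulrnAl !mulrnAr; congr (_ *+ _); rewrite mulrCA mulrA.
Qed.

Hypothesis F_char0 : [pchar F] =i pred0.

Lemma natr_eq0 n : (n%:R == 0 :> F) = (n == 0%N).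
Proof. by move: n; apply/pcharf0P. Qed.

Lemma factr_neq0 n : n`!%:R != 0 :> F.
Proof. by rewrite natr_eq0 -lt0n fact_gt0. Qed.

Lemma fps_pchar0 : [pchar {fps F}] =i pred0.
Proof.
apply/pcharf0P => n; apply/idP/eqP => [|->//].
rewrite -(rmorph_nat (@fpsC F)) => /eqP/fpsP/(_ 0%N)/eqP /=.
by rewrite natr_eq0 => /eqP.
Qed.

Lemma factr_fps_unit n : n`!%:R \is a @GRing.unit {fps F}.
Proof.
by rewrite -(rmorph_nat (@fpsC F)) rmorph_unit // unitfE factr_neq0.
Qed.

Lemma euler_inj f g : f 0%N = g 0%N -> euler f = euler g -> f = g.
Proof.
move=> fg0 /fpsP fg; apply/fpsP => -[//|n]; have /eqP := fg n.+1.
rewrite !coefs_euler -subr_eq0 -mulrnBl -mulr_natl mulf_eq0 natr_eq0 subr_eq0.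
by move=> /eqP.
Qed.

(** As [u] has no constant term, degree n of the equation expresses n f_n through the f_i with i <
    n; in characteristic zero this recursion determines f from f_0. *)
Lemma euler_ode_uniq (u f g : {fps F}) : u 0%N = 0 -> f 0%N = g 0%N ->
  euler f = u * f -> euler g = u * g -> f = g.
Proof.
move=> u0 fg0 uf ug; apply/fpsP => n.
elim/ltn_ind: n => -[//|n] IHn.
have /eqP : euler f n.+1 = euler g n.+1.
  rewrite uf ug !coefsM big_ord_recl [RHS]big_ord_recl u0 !mul0r.
  congr (_ + _); apply: eq_bigr => i _; rewrite IHn //= /bump /=.
  by rewrite add1n subSS ltnS leq_subr.
rewrite !coefs_euler -subr_eq0 -mulrnBl -mulr_natl mulf_eq0 natr_eq0 subr_eq0.
by move=> /eqP.
Qed.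

Lemma fps_exp0 f : fps_exp f 0%N = 1.
Proof. by rewrite /= big_ord1 expr0 coefs1 /= fact0 divr1. Qed.

Lemma euler_exp f : f 0%N = 0 -> euler (fps_exp f) = euler f * fps_exp f.
Proof.
move=> f0; rewrite fps_expE euler_comp //; congr (_ * _); apply/fpsP => n /=.
apply: eq_bigr => i _; rewrite factS natrM invfM.
by rewrite -[_ / _ *+ _]mulr_natl [_ * (_ * _)]mulrA mulfV ?mul1r // natr_eq0.
Qed.

Lemma exp_uniq f g : f 0%N = 0 -> g 0%N = 1 -> euler g = euler f * g ->
  g = fps_exp f.
Proof.
move=> f0 g0 gf; apply: (@euler_ode_uniq (euler f)) => //.
  by rewrite fps_exp0.
exact: euler_exp.
Qed.

(** The coefficients of log(1 + u), so the argument below is g - 1. *)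
Definition log_coef (k : nat) : F :=
  if k is k'.+1 then (-1) ^+ k' / k'.+1%:R else 0.

(** Differentiating log(1 + u) at u = g - 1 gives the geometric series in 1 - g. Its truncation
    times g telescopes to 1 - (1 - g)^(n+1), and the last power vanishes in degree n. *)
Lemma log_uniq f g : f 0%N = 0 -> g 0%N = 1 -> euler g = euler f * g ->
  f = fps_comp log_coef (g - 1).
Proof.
move=> f0 g0 gf.
have u0 : (g - 1) 0%N = 0 by rewrite coefsD coefsN g0 coefs1 subrr.
apply: euler_inj; first by rewrite f0 /= big_ord1 mulr0.
have gn0 : g != 0.
  apply/eqP => gE; move: g0; rewrite gE coefs0 => /eqP.
  by rewrite eq_sym oner_eq0.
apply: (mulIf gn0); rewrite -gf euler_comp //.
rewrite raddfB /= -[X in euler g - euler X]/(fpsC 1) eulerC subr0 -mulrA.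
rewrite -[LHS]mulr1; congr (_ * _); apply/fpsP => n.
rewrite (@coefsM_agree n _ _ _ g (fun m mn => fps_compE _ u0 mn)) //.
have -> : \sum_(k < n.+1) (g - 1) ^+ k * fpsC (log_coef k.+1 *+ k.+1)
   = \sum_(k < n.+1) (1 - g) ^+ k.
  apply: eq_bigr => i _.
  rewrite -[log_coef _ *+ _]mulr_natr /log_coef divfK ?natr_eq0 //.
  by rewrite rmorphXn rmorphN1 -exprMn mulrN1 opprB.
have -> : (\sum_(k < n.+1) (1 - g) ^+ k) * g = 1 - (1 - g) ^+ n.+1.
  by rewrite -[RHS]opprB subrX1 addrAC subrr add0r mulNr opprK mulrC.
rewrite coefsD coefsN (@coefsX_eq0 1) ?subr0 ?mul1n //.
by case=> // _; rewrite coefsD coefsN g0 coefs1 subrr.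
Qed.

(** In odd degree n, every product of coefficients f_i g_(n-i) with i < n has an odd index, hence
    vanishes by induction or by hypothesis; what remains is n f_n = 0. *)
Lemma log_even f g : g 0%N = 1 -> euler g = euler f * g ->
  (forall n, odd n -> g n = 0) -> forall n, odd n -> f n = 0.
Proof.
move=> g0 gf godd n; elim/ltn_ind: n => n IHn oddn.
have := congr1 (fun h : {fps F} => h n) gf.
rewrite /= godd // mul0rn big_ord_recr /= subnn g0 mulr1 big1 ?add0r.
  move=> /esym/eqP; rewrite -mulr_natl mulf_eq0 natr_eq0.
  by case: n oddn {IHn} => //= n _ /eqP.
move=> i _; have [oi|ei] := boolP (odd i); first by rewrite IHn // mul0rn mul0r.
by rewrite godd ?mulr0 // oddB ?oddn ?(negbTE ei) // ltnW.
Qed.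

(** * Partitions from composition with an even series *)

Lemma plength_le k (l : freq k) : is_partn l -> (plength l <= k)%N.
Proof.
by move=> /eqP {2}<-; apply: leq_sum => j _; rewrite leq_pmull.
Qed.

Lemma plength_gt0 k (l : freq k) : (0 < k)%N -> is_partn l -> (0 < plength l)%N.
Proof.
move=> k0 lk; rewrite lt0n; apply: contraTneq lk => /eqP.
rewrite sum_nat_eq0 => /forallP l0; rewrite /is_partn big1 ?ltn_eqF // => j _.
by rewrite (eqP (l0 j)) muln0.
Qed.

(** Up to degree 2k, f is the sum of the monomials f_(2j) X^(2j) with 1 <= j <= k. Expanding f^r by
    the multinomial theorem, the terms of degree 2k are indexed by the partitions of k of length
    r. *)
Lemma comp_even c f k : (forall n, odd n -> f n = 0) -> f 0%N = 0 ->
  fps_comp c f (2 * k)%N =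
  \sum_(l : freq k | is_partn l)
     c (plength l) * (plength l)`!%:R *
     \prod_(j < k) (f (2 * j.+1)%N ^+ l j / (l j)`!%:R).
Proof.
move=> fodd f0.
pose a (j : 'I_k) := fpsC (f (2 * j.+1)%N) * fpsXn (2 * j.+1)%N.
have fa n : (n <= 2 * k)%N -> f n = (\sum_j a j) n.
  move=> nk; rewrite coefs_sum.
  have aE j : a j n = if n == (2 * j.+1)%N then f n else 0.
    by rewrite coefsCM /=; case: eqP => [->|_]; rewrite ?mulr1 ?mulr0.
  under eq_bigr do rewrite aE.
  have [on|en] := boolP (odd n).
    by rewrite fodd // big1 // => j _; case: ifP.
  case: n en nk {aE} => [|n en nk].
    by rewrite f0 big1 // => j _; case: ifP.
  have jP : (n.+1./2.-1 < k)%N by lia.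
  rewrite (bigD1 (Ordinal jP)) //= ifT; last lia.
  rewrite big1 ?addr0 // => j; rewrite -val_eqE /= => jn; rewrite ifF //; lia.
(* Having order at least 2, f has no power beyond the k-th that reaches degree 2k. *)
have f1 m : (m < 2)%N -> f m = 0 by case: m => [|[|]] // _; rewrite fodd.
rewrite [LHS]/= (bigID (fun r : 'I__ => (r < k.+1)%N)) /=.
rewrite [X in _ + X]big1 ?addr0; last first.
  by move=> r rk; rewrite (coefsX_eq0 f1) ?mul0r //; lia.
have -> : \sum_(r < (2 * k).+1 | (r < k.+1)%N)
      (f ^+ r) (2 * k)%N * c r = \sum_(r < k.+1) (f ^+ r) (2 * k)%N * c r.
  rewrite [RHS](big_ord_widen (2 * k).+1 (fun r => (f ^+ r) (2 * k)%N * c r)).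
    by [].
  lia.
(* Partitions are grouped by length; [inord] loses nothing, since the length is at most k. *)
pose part_length (l : freq k) : 'I_k.+1 := inord (plength l).
rewrite [RHS](partition_big part_length predT) //; apply: eq_bigr => r _.
rewrite (coefsX_agree r fa (leqnn _)).
rewrite (@exprn_sum _ factr_fps_unit _ _ k); last by rewrite -ltnS.
rewrite coefs_sum mulr_suml big_mkcond [RHS]big_mkcond.
apply: eq_bigr => l _.
have -> : \prod_i (a i ^+ l i / (l i)`!%:R)
   = fpsC (\prod_(j < k) (f (2 * j.+1)%N ^+ l j / (l j)`!%:R))
     * fpsXn (2 * \sum_(j < k) j.+1 * l j)%N.
  rewrite rmorph_prod fpsXnM expr_sum -big_split /=.
  apply: eq_bigr => j _.
  by rewrite exprMn fpsXnM -exprM rmorphM fmorphV rmorphXn rmorph_nat mulrAC.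
rewrite -(rmorph_nat (@fpsC F) r`!). rewrite mulrA -rmorphM coefsCM.
rewrite [fpsXn _ _]/= eqn_pmul2l // [k == _]eq_sym -/(is_partn l).
have [lk|] := boolP (is_partn l); last first.
  by rewrite mulr0n mulr0 mul0r if_same.
rewrite -/(plength l) -[part_length l == r]val_eqE /=.
rewrite inordK ?ltnS ?plength_le //.
case: eqP => // ->; rewrite mulr1n; ring.
Qed.

(** * Bernoulli numbers and the logarithm of sinh *)

Definition fps_expX (a : F) : {fps F} := Fps (fun n => a ^+ n / n`!%:R).

Lemma fps_expXD a b : fps_expX (a + b) = fps_expX a * fps_expX b.
Proof.
apply/fpsP => n; rewrite coefsM /= addrC exprDn mulr_suml.
apply: eq_bigr => i _.
have iN : (i <= n)%N by rewrite -ltnS.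
have := bin_fact iN => /(congr1 (fun n => n%:R : F)); rewrite !natrM => <-.
have := factr_neq0 i; have := factr_neq0 (n - i).
have : 'C(n, i)%:R != 0 :> F by rewrite natr_eq0 -lt0n bin_gt0.
move=> h1 h2 h3; rewrite -mulr_natr; field; by rewrite h1 h2 h3.
Qed.

Lemma fps_expX0 : fps_expX 0 = 1.
Proof.
apply/fpsP => -[|n]; rewrite coefs1 /= ?expr0 ?fact0 ?divr1 //.
by rewrite expr0n mul0r.
Qed.

Lemma euler_expX a : euler (fps_expX a) = fpsC a * fpsXn 1 * fps_expX a.
Proof.
apply/fpsP => -[|n]; rewrite -mulrA coefsCM [fpsXn 1 * _]mulrC coefsMXn /=.
  by rewrite mulr0n mulr0.
rewrite subn1 /= factS natrM exprS -[LHS]mulr_natr.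
have := factr_neq0 n; have : n.+1%:R != 0 :> F by rewrite natr_eq0.
by move: n.+1%:R n`!%:R => x y x0 y0; field; rewrite x0 y0.
Qed.

(** The Bernoulli numbers enter through their recurrence alone, so that their image in any field of
    characteristic zero will do. *)
Variable b : nat -> F.
Hypothesis b_rec : forall n,
  \sum_(k < n.+1) 'C(n.+1, k)%:R * b k = (n == 0)%N%:R.

Definition bernoulli_egf a : {fps F} := Fps (fun n => b n * a ^+ n / n`!%:R).

(** The -1 cancels the top term of the convolution; in each positive degree n the rest is the
    Bernoulli recurrence scaled by a^n / n!. *)
Lemma bernoulli_egfE a :
  bernoulli_egf a * (fps_expX a - 1) = fpsC a * fpsXn 1.
Proof.
apply/fpsP => n; rewrite mulrBr mulr1 coefsD coefsN coefsCM coefsM.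
rewrite big_ord_recr /=.
rewrite subnn expr0 fact0 divr1 mulr1 addrK.
case: n => [|n]; first by rewrite big_ord0 mulr0.
transitivity (a ^+ n.+1 / n.+1`!%:R * \sum_(k < n.+1) 'C(n.+1, k)%:R * b k).
  rewrite mulr_sumr; apply: eq_bigr => i _.
  have iN : (i <= n.+1)%N by apply: ltnW.
  have := bin_fact iN => /(congr1 (fun n => n%:R : F)); rewrite !natrM => <-.
  have -> : a ^+ n.+1 = a ^+ i * a ^+ (n.+1 - i) by rewrite -exprD subnKC.
  have := factr_neq0 i; have := factr_neq0 (n.+1 - i).
  have : 'C(n.+1, i)%:R != 0 :> F by rewrite natr_eq0 -lt0n bin_gt0.
  by move=> h1 h2 h3; field; rewrite h1 h2 h3.
rewrite b_rec eqSS; case: n => [|n]; last by rewrite !mulr0.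
by rewrite factS fact0 divr1.
Qed.

(* [log(sinh(aX/2) / (aX/2))], see [euler_sinhc]. *)
Definition log_sinhc a : {fps F} :=
  Fps (fun n => if (2 <= n)%N then b n / n%:R * a ^+ n / n`!%:R else 0).

Lemma coefs_log_sinhc a n : (1 < n)%N ->
  log_sinhc a n = 2 * (b n / (2 * n)%:R) * (a ^+ n / n`!%:R).
Proof.
move=> n1; rewrite /= n1 natrM.
have : n%:R != 0 :> F by rewrite natr_eq0 -lt0n ltnW.
have : 2 != 0 :> F by rewrite natr_eq0.
have := factr_neq0 n.
by move: n`!%:R n%:R => x y x0 two0 y0; field; rewrite x0 two0 y0.
Qed.

(* With [beta] the generating series of the [b_n], [beta (e^(aX) - 1) = aX]
   gives [beta S = e^(-hX)] for [a = 2 h]; differentiating [aX S] then yields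
   [X S' = (beta - 1 + hX) S], and [- 1 + hX] cancels [b_0 + b_1 aX]. *)
Lemma euler_sinhc (S : {fps F}) h : h != 0 ->
  fpsC (2 * h) * fpsXn 1 * S = fps_expX h - fps_expX (- h) ->
  euler S = euler (log_sinhc (2 * h)) * S.
Proof.
move=> h0 SE.
have two0 : 2 != 0 :> F by rewrite natr_eq0.
pose a := 2 * h; have a0 : a != 0 by rewrite mulf_neq0.
have aX0 : fpsC a * fpsXn 1 != 0 by rewrite mulf_neq0 ?fpsXn_neq0 ?fmorph_eq0.
have expN : fps_expX h * fps_expX (- h) = 1.
  by rewrite -fps_expXD subrr fps_expX0.
have expa : fps_expX a = fps_expX h * fps_expX h.
  by rewrite -fps_expXD /a mulr_natl.
have bS : bernoulli_egf a * S = fps_expX (- h).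
  apply: (mulfI aX0); rewrite mulrCA SE -bernoulli_egfE expa.
  transitivity (bernoulli_egf a *
    (fps_expX h * (fps_expX h * fps_expX (- h)) - fps_expX (- h))).
    by rewrite expN mulr1.
  ring.
(* Applying [euler] to [SE] gives aX (S + XS') on the left and hX (e^(hX) + e^(-hX)) on the right;
   the factor 2 is a / h. *)
have thS : (S + euler S) *+ 2 = fps_expX h + fps_expX (- h).
  apply: (mulfI aX0); have := congr1 euler SE.
  rewrite -/a raddfB /= 2!eulerM eulerC mul0r add0r euler_fpsXn !euler_expX.
  rewrite rmorphN.
  rewrite mulr1n => eS.
  have -> : fpsC a * fpsXn 1 * ((S + euler S) *+ 2)
      = (fpsC a * fpsXn 1 * S + fpsC a * fpsXn 1 * euler S) *+ 2 by ring.
  rewrite eS /a rmorphM rmorph_nat; ring.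
have b0 : b 0%N = 1 by have := b_rec 0; rewrite big_ord1 /= bin0 mul1r.
have b1 : b 1%N = - 2^-1.
  have := b_rec 1; rewrite big_ord_recr big_ord1 /= bin0 bin1 b0 mulr1 => /eqP.
  rewrite addrC addr_eq0 => /eqP bE.
  by apply: (mulfI two0); rewrite mulrN divff.
have -> : euler (log_sinhc a) = bernoulli_egf a - 1 + fpsC h * fpsXn 1.
  apply/fpsP => n; rewrite 2!coefsD coefsN coefs1 coefsCM /=.
  case: n => [|[|n]] /=.
  - by rewrite b0 expr0 fact0 divr1 mulr1 subrr mulr0 addr0.
  - rewrite mul0rn b1 factS fact0 divr1 expr1 subr0 mulr1 /a.
    by rewrite mulNr mulKf // addNr.
  rewrite mulr0 addr0 subr0 -[LHS]mulr_natr.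
  have := factr_neq0 n.+2; have : n.+2%:R != 0 :> F by rewrite natr_eq0.
  by move: n.+2%:R n.+2`!%:R => x y x0 y0; field; rewrite x0 y0.
have two0' : 2 != 0 :> {fps F} by have /pcharf0P -> := fps_pchar0.
(* After doubling, both sides reduce to e^(hX) + e^(-hX) - 2S. *)
apply: (mulfI two0').
transitivity ((S + euler S) *+ 2 - 2 * S); first by ring.
transitivity (2 * (bernoulli_egf a * S) - 2 * S + fpsC a * fpsXn 1 * S);
  last first.
  by rewrite /a rmorphM rmorph_nat; ring.
by rewrite thS bS SE; ring.
Qed.

End FormalSeries.

(** * Exponential and logarithm as partition traces *)

(** The powers of z multiply to z^(2k) for every partition of k, so the scale is common to all terms
    of a trace. *)
Lemma prod_rescale (F : fieldType) k (l : freq k) (x : nat -> F) (z : F) :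
  is_partn l ->
  \prod_(j < k) ((x j.+1 * (z ^+ (2 * j.+1) / (2 * j.+1)`!%:R)) ^+ l j
                 / (l j)`!%:R) =
  z ^+ (2 * k) * ((\prod_(j < k) ((l j)`!%:R * (2 * j.+1)`!%:R ^+ l j)^-1)
                  * \prod_(j < k) x j.+1 ^+ l j).
Proof.
move=> /eqP lk.
have -> : z ^+ (2 * k) = \prod_(j < k) (z ^+ (2 * j.+1)) ^+ l j.
  rewrite exprM -[X in _ ^+ X = _]lk expr_sum; apply: eq_bigr => j _.
  by rewrite -!exprM mulnA.
rewrite -!big_split /=; apply: eq_bigr => j _.
by rewrite !exprMn exprVn invfM; ring.
Qed.

Section EvenLog.
Variable F : fieldType.
Hypothesis F_char0 : [pchar F] =i pred0.
(** In the application z is 2 pi i, [x j] is H_(2j) + B_(2j) / (4j), [mu j] is the moment of order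
    2j, and g = exp f. *)
Variables (z : F) (x mu : nat -> F) (f g : {fps F}).
Hypothesis z_neq0 : z != 0.
Hypothesis f0 : f 0%N = 0.
Hypothesis g0 : g 0%N = 1.
Hypothesis g_odd : forall n, odd n -> g n = 0.
Hypothesis euler_g : euler g = euler f * g.
Hypothesis f_even : forall j, (0 < j)%N ->
  f (2 * j)%N = 2 * x j * (z ^+ (2 * j) / (2 * j)`!%:R).
Hypothesis g_even : forall j, (0 < j)%N ->
  g (2 * j)%N = mu j * (z ^+ (2 * j) / (2 * j)`!%:R).

Let scale_neq0 k : z ^+ (2 * k) / (2 * k)`!%:R != 0.
Proof.
exact: mulf_neq0 (expf_neq0 _ z_neq0) (invr_neq0 (factr_neq0 F_char0 _)).
Qed.

(** The coefficient 1 / r! of exp cancels the r! of the multinomial theorem, so the length leaves no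
    trace; the powers of 2 come from [f_even]. *)
Lemma exp_trace k : (0 < k)%N ->
  mu k = \sum_(l : freq k | is_partn l)
    (2 * k)`!%:R
    * \prod_(j < k) (2 ^+ l j / ((l j)`!%:R * (2 * j.+1)`!%:R ^+ l j))
    * \prod_(j < k) x j.+1 ^+ l j.
Proof.
move=> k_gt0; apply: (mulIf (scale_neq0 k)); rewrite -g_even //.
rewrite (exp_uniq F_char0 f0 g0 euler_g) fps_expE comp_even //; last first.
  exact: log_even euler_g g_odd.
rewrite mulr_suml; apply: eq_bigr => l lk.
under eq_bigr do rewrite f_even //.
rewrite (prod_rescale (fun j => 2 * x j)) // mulVf ?factr_neq0 // mul1r.
under [X in _ * (_ * X)]eq_bigr do rewrite exprMn.
rewrite !big_split /=; have := factr_neq0 F_char0 (2 * k).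
by move: (z ^+ _) (_`!%:R) => u v v0; field.
Qed.

(** The coefficient (-1)^(r-1) / r of the logarithm turns the multinomial r! into (r-1)!; the
    division by 2 undoes the factor in [f_even]. *)
Lemma log_trace k : (0 < k)%N ->
  x k = \sum_(l : freq k | is_partn l)
    (2 * k)`!%:R / 2 * (-1) ^+ (plength l).-1 * ((plength l).-1)`!%:R
    * \prod_(j < k) ((l j)`!%:R * (2 * j.+1)`!%:R ^+ l j)^-1
    * \prod_(j < k) mu j.+1 ^+ l j.
Proof.
move=> k_gt0; have two0 : 2 != 0 :> F by rewrite natr_eq0.
apply: (mulfI two0); apply: (mulIf (scale_neq0 k)); rewrite -f_even //.
rewrite (log_uniq F_char0 f0 g0 euler_g) comp_even //; first last.
- by rewrite coefsD coefsN g0 coefs1 subrr.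
- by case=> // n on; rewrite coefsD coefsN g_odd // coefs1 subr0.
rewrite mulr_sumr mulr_suml; apply: eq_bigr => l lk.
under eq_bigr do rewrite coefsD coefsN coefs1 subr0 g_even //.
rewrite (prod_rescale mu) //.
(* A positive k forces a positive length, so the predecessor is genuine and [log_coef] is in its
   nonzero branch. *)
have := plength_gt0 k_gt0 lk; case: (plength l) => // p _.
rewrite factS natrM /=; have := factr_neq0 F_char0 (2 * k).
have : p.+1%:R != 0 :> F by rewrite natr_eq0.
move: (z ^+ _) ((2 * k)`!%:R) (p`!%:R) (p.+1%:R) => u v w y y0 v0.
by field; rewrite two0 v0 y0.
Qed.

End EvenLog.

(** * The field of q-series and the sine factor *)

Section QSeries.
Variable R : realType.

HB.instance Definition _ :=
  GRing.RMorphism.copy (@qconst R) (@tofrac {fps R[i]} \o @fpsC R[i]).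

Lemma qser_pchar0 : [pchar qser R] =i pred0.
Proof.
by apply/pcharf0P => n; rewrite -(rmorph_nat (@qconst R)) fmorph_eq0 pnatr_eq0.
Qed.

(* [ratr] is canonically a morphism only into a [numFieldType]; [qser R] has no
   order. *)
Definition ratq (x : rat) : qser R := qconst (ratr x).
HB.instance Definition _ :=
  GRing.RMorphism.copy ratq (@qconst R \o @ratr R[i]).

Lemma ratr_qser (x : rat) : ratr x = ratq x.
Proof. by rewrite /ratq fmorph_rat. Qed.

Lemma qser_bernoulli_rec n :
  \sum_(k < n.+1) 'C(n.+1, k)%:R * ratr (bernoulli k) = (n == 0)%N%:R :> qser R.
Proof.
rewrite -[RHS](rmorph_nat ratq) -bernoulli_rec rmorph_sum.
by apply: eq_bigr => i _; rewrite rmorphM rmorph_nat ratr_qser.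
Qed.

Let pii : R[i] := Complex 0 pi.

Lemma twopiiE : twopii R = 2 * pii.
Proof.
rewrite mulr_natl mulr2n; apply/eqP.
by rewrite eq_complex /= addr0 eqxx mulr_natl mulr2n eqxx.
Qed.

Lemma pii_neq0 : pii != 0.
Proof. by rewrite eq_complex /= (gt_eqF (pi_gt0 R)) andbF. Qed.

(** Euler's formula for 2i sin(pi z), in the shape that [euler_sinhc] expects with h = i pi. *)
Lemma sinczE :
  fpsC (2 * qconst pii) * fpsXn _ 1 * sincz R =
  fps_expX (qconst pii) - fps_expX (- qconst pii).
Proof.
apply/fpsP => n; rewrite -mulrA coefsCM [fpsXn _ 1 * _]mulrC coefsMXn.
rewrite coefsD coefsN /=.
case: n => [|n]; first by rewrite !expr0 subrr mulr0.
rewrite subn1 /= -rmorphN -!rmorphXn -(rmorph_nat (@qconst R) 2).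
rewrite -(rmorph_nat (@qconst R) _`!) -!fmorph_div -rmorphB -!rmorphM.
congr (qconst _).
rewrite -mulrBl exprNn /sin_coeff /= -[in RHS]signr_odd [odd n.+1]/=.
have [on|en] := boolP (odd n).
  by rewrite !mul0r rmorph0 mulr0 expr0 mul1r subrr mul0r.
rewrite expr1 mulN1r opprK mul1r.
(* For even n, i^(n+1) = i (-1)^(n/2) provides the sign of the sine coefficient. *)
have piiX : pii ^+ n.+1 = pii * ((-1) ^+ n./2 * real_complex R pi ^+ n).
  have pii2 : pii ^+ 2 = - real_complex R pi ^+ 2.
    apply/eqP; rewrite eq_complex /=; apply/andP; split; apply/eqP; ring.
  rewrite exprS -{1}(even_halfK en) -mul2n exprM pii2 (exprNn (_ ^+ 2)).
  by rewrite -exprM mul2n even_halfK.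
rewrite piiX !rmorphM !fmorphV !rmorphXn rmorphN1 rmorph_nat /=.
have P0 : real_complex R pi != 0 by rewrite fmorph_eq0 gt_eqF ?pi_gt0.
have := pnatr_eq0 R[i] n.+1`!; rewrite eqn0Ngt fact_gt0 /= => /negbT.
rewrite exprS.
move: (_ ^+ n) (_ ^+ n./2) (n.+1`!%:R) => x y w w0.
by move: (real_complex R pi) P0 => P P0; field; rewrite P0 w0.
Qed.
End QSeries.

(** * Moments as Taylor coefficients in z *)

Section Moments.
Variables (R : realType) (T : choiceType) (wt : T -> nat) (s : T -> int).

Lemma wgf_scale (a : R[i]) w :
  wgf wt s (fun m => a * w m) = fpsC a * wgf wt s w.
Proof.
apply/fpsP => n; rewrite coefsCM /= mulr_fsumr.
by apply: eq_fsbigr => m _; rewrite mulrA.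
Qed.

Lemma Gz_moment r : G1 R wt s != 0 ->
  Gz R wt s r = qconst (twopii R ^+ r / r`!%:R) * moment R wt s r * G1 R wt s.
Proof.
move=> G0; rewrite /moment -mulrA divfK // /qconst -tofracM -wgf_scale.
congr (tofrac (wgf _ _ _)); apply/funext => m.
by rewrite /= exprMn mulrAC.
Qed.

Lemma moment0 : G1 R wt s != 0 -> moment R wt s 0 = 1.
Proof.
move=> G0; rewrite /moment (_ : wgf _ _ _ = wgf wt s (fun=> 1)) ?divff //.
Qed.

(** The substitution of -m for m preserves the counts and negates m^r, so each coefficient equals
    its opposite. *)
Lemma moment_odd r : (forall m n, nobj wt s m n = nobj wt s (- m) n) ->
  odd r -> moment R wt s r = 0.
Proof.
move=> sym oddr; rewrite /moment (_ : wgf _ _ _ = 0) ?rmorph0 ?mul0r //.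
apply/fpsP => n; rewrite coefs0.
apply/eqP; rewrite -eqNr; apply/eqP.
rewrite /= [RHS](reindex_fsbigT (@GRing.opp int)); last exact: inv_bij opprK.
rewrite -mulN1r mulr_fsumr; apply: eq_fsbigr => m _.
by rewrite -sym rmorphN exprNn -signr_odd oddr expr1 mulrA.
Qed.

End Moments.


(** * The two trace formulas *)

Lemma sincz_euler (R : realType) :
  euler (sincz R) =
  euler (log_sinhc (fun n => ratr (bernoulli n)) (qconst (twopii R))) * sincz R.
Proof.
rewrite twopiiE rmorphM rmorph_nat.
apply: (euler_sinhc (@qser_pchar0 R) (@qser_bernoulli_rec R)).
  by rewrite fmorph_eq0 pii_neq0.
exact: sinczE.
Qed.

Theorem theorem1p3 (R : realType) (T : choiceType) (wt : T -> nat)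
    (s : T -> int) (H : nat -> qser R)
    (fin_wt : forall n : nat, finite_set [set x | wt x = n])
    (G1_neq0 : G1 R wt s != 0)
    (nobj_sym : forall (m : int) (n : nat), nobj wt s m n = nobj wt s (- m) n)
    (G_exp : Gz R wt s = sincz R * fpsC (G1 R wt s) * fps_exp (Hexponent H))
    (k : nat) (k_gt0 : (0 < k)%N) :
  moment R wt s (2 * k) =
    ptrace (@phi_M k)
      (fun j => H (2 * j)%N + ratr (bernoulli (2 * j) / (4 * j)%:R))
  /\
  H (2 * k)%N =
    - ratr (bernoulli (2 * k) / (4 * k)%:R)
    + ptrace (@phi_S k) (fun j => moment R wt s (2 * j)).
Proof.
have char0 := @qser_pchar0 R.
set z := qconst (twopii R).
set X := fun j : nat => _ + _.
have z_neq0 : z != 0.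
  by rewrite fmorph_eq0 twopiiE mulf_neq0 ?pnatr_eq0 ?pii_neq0.
pose L := log_sinhc (fun n => ratr (bernoulli n)) z + Hexponent H.
pose M := sincz R * fps_exp (Hexponent H).
have M_moment r : M r = moment R wt s r * (z ^+ r / r`!%:R).
  apply: (mulIf G1_neq0); rewrite mulrAC mulrC mulrA -coefsCM.
  have -> : fpsC (G1 R wt s) * M = Gz R wt s by rewrite G_exp /M mulrCA mulrA.
  rewrite Gz_moment // rmorphM fmorphV rmorphXn rmorph_nat -/z; ring.
have L0 : L 0%N = 0 by rewrite coefsD addr0.
have Lk j : (0 < j)%N ->
    L (2 * j)%N = (2 * X j) * (z ^+ (2 * j) / (2 * j)`!%:R).
  (* Positivity of j puts 2j in the range n >= 2, where neither summand of [L] takes its default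
     value 0. *)
  move=> j0; have j1 : (1 < 2 * j)%N by lia.
  rewrite coefsD coefs_log_sinhc //= j1.
  rewrite rmorphM fmorphV rmorphXn rmorph_nat -/z -mulrDl -mulrDr /X addrC.
  by rewrite !ratr_qser rmorphM fmorphV rmorph_nat mulnA.
have euler_M : euler M = euler L * M.
  rewrite eulerM sincz_euler euler_exp // raddfD /M; ring.
have M0 : M 0%N = 1 by rewrite M_moment moment0 // expr0 fact0 divr1 mulr1.
have M_odd n : odd n -> M n = 0.
  by move=> on; rewrite M_moment moment_odd ?mul0r.
split.
  rewrite [LHS](exp_trace char0 z_neq0 L0 M0 M_odd euler_M Lk
    (fun j _ => M_moment _)) //.
  apply: eq_bigr => l lk; congr (_ * _).
  rewrite ratr_qser rmorphM rmorph_nat rmorph_prod; congr (_ * _).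
  apply: eq_bigr => j _.
  by rewrite rmorphM fmorphV rmorphXn rmorphM rmorphXn !rmorph_nat.
(* The Bernoulli term moves to the left, where [X k] appears, the quantity given by [log_trace]. *)
apply/eqP; rewrite -(can2_eq (addNKr _) (addKr _)) opprK addrC; apply/eqP.
rewrite [LHS](log_trace char0 z_neq0 L0 M0 M_odd euler_M Lk
  (fun j _ => M_moment _)) //.
apply: eq_bigr => l lk; congr (_ * _).
rewrite ratr_qser rmorphM rmorph_prod; congr (_ * _).
  by rewrite !rmorphM fmorphV rmorphXn rmorphN1 !rmorph_nat.
apply: eq_bigr => j _.
by rewrite fmorphV rmorphM rmorphXn !rmorph_nat.
Qed.
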